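(* Let $G$ be an ordered group with identity $e$ and let $K\triangleleft G$ be a proper normal subgroup which is a strong module (containing $e$). Then $$\mathcal V(G/K)=\{H/K:H\in\mathcal V(G),\ K<H\},$$ and, for every $g\in G\setminus K$, $$S_{G/K}(K,gK)=S_G(e,g)/K.$$ Moreover, if $H\in\mathcal V(G)$ and $K<H$ (strict inclusion), then $K\le H^-$, $(H/K)^-=H^-/K$, and the corresponding canonical factor $(H/K)/(H/K)^-$ is naturally order-isomorphic (as an ordered group) to $H/H^-$.
   Context: An ordered group is a group $G$ (identity $e$) equipped with a partial order $\le$ such that $x\le y$ implies $axb\le ayb$ for all $a,b,x,y\in G$. A module of a poset $X$ is a subset $M$ such that for every $x\in X\setminus M$ and $m,m'\in M$: $x\le m\iff x\le m'$ and $m\le x\iff m'\le x$. A nonempty module $M$ is strong if every module is disjoint from $M$, contained in $M$, or contains $M$. For an ordered group $G$, $S_G(x,y)$ is the least strong module of the poset $G$ containing $x$ and $y$; $\mathcal V(G):=\{S_G(e,g):g\ne e\}$, and $H^-:=\{e\}\cup\bigcup\{L\in\mathcal V(G):L\subsetneq H\}$ for $H\in\mathcal V(G)$. It is known that $\mathcal V(G)$ is a chain under inclusion of convex subgroups and that $H^-$ is a proper convex normal subgroup of $H$. Every strong module containing $e$ is a convex subgroup. For a convex normal subgroup $N$ of an ordered group $H$, $H/N$ is the ordered group with order $\alpha\le\beta$ iff $a\le b$ for some $a\in\alpha$, $b\in\beta$. The notations $\mathcal V(G/K)$, $S_{G/K}$ and $(H/K)^-$ are those above applied to the ordered group $G/K$,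 whose identity is the coset $K$. *)

(* Defs.v *)
From HB Require Import structures.
From mathcomp Require Import all_boot all_order.
From mathcomp Require Import boolp classical_sets.

Set Implicit Arguments.
Unset Strict Implicit.
Unset Printing Implicit Defensive.

Import Order.TTheory.
Local Open Scope order_scope.
Local Open Scope group_scope.
Local Open Scope classical_set_scope.

HB.mixin Record Group_POrder_isOrderedGroup (d : Order.disp_t) G
    of Group G & Order.POrder d G := {
  le_mulg2 : forall a b x y : G, x <= y -> a * x * b <= a * y * b
}.

#[short(type="orderedGroupType")]
HB.structure Definition OrderedGroup (d : Order.disp_t) :=
  { G of Group G & Order.POrder d G & Group_POrder_isOrderedGroup d G }.

Section Modules.
Context {d : Order.disp_t} {X : porderType d}.
Implicit Types M N : set X.

Definition poset_module M :=
  forall x m m', ~ M x -> M m -> M m' ->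
    (x <= m <-> x <= m') /\ (m <= x <-> m' <= x).

Definition strong_module M :=
  [/\ M !=set0, poset_module M &
      forall N, poset_module N ->
        [\/ N `&` M = set0, N `<=` M | M `<=` N]].

Definition convex M :=
  forall x y z, M x -> M z -> x <= y -> y <= z -> M y.

(* S_X(x, y); lemma [least_strong_moduleP] below shows that the intersection
   is itself a strong module. *)
Definition least_strong_module (x y : X) : set X :=
  \bigcap_(M in [set M | [/\ strong_module M, M x & M y]]) M.

Lemma poset_module_convex M : poset_module M -> convex M.
Proof.
move=> hM x y z Mx Mz xy yz; apply: contrapT => nMy.
have [h1 _] := hM y x z nMy Mx Mz.
have exy : x = y by apply/eqP; rewrite eq_le xy; apply/h1.
by apply: nMy; rewrite -exy.
Qed.

Lemma strong_module_convex M : strong_module M -> convex M.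
Proof. by case=> _ hM _; exact: poset_module_convex. Qed.

Lemma strong_module_setT (x : X) : strong_module [set: X].
Proof.
split; first by exists x.
- by move=> y m m' [].
- by move=> N _; apply: Or32.
Qed.

Lemma least_strong_moduleP (x y : X) :
  [/\ strong_module (least_strong_module x y),
      least_strong_module x y x, least_strong_module x y y &
      forall M, strong_module M -> M x -> M y ->
        least_strong_module x y `<=` M].
Proof.
have Sx : least_strong_module x y x by move=> M [].
have Sy : least_strong_module x y y by move=> M [].
split=> //; last by move=> M sM Mx My z; apply.
split; first by exists x.
- move=> z m m' nz hm hm'; apply: contrapT => C; apply: nz => M hMM.
  case: (hMM) => -[_ modM _] _ _; apply: contrapT => nMz; apply: C.
  exact: modM nMz (hm _ hMM) (hm' _ hMM).
- move=> N modN.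
  have [[M hM NM0]|nodisj] := pselect (exists2 M,
      [/\ strong_module M, M x & M y] & N `&` M = set0).
    apply: Or31; rewrite -subset0 => z [Nz Sz]; rewrite -NM0.
    by split=> //; exact: Sz.
  have [[M hM MN]|nosub] := pselect (exists2 M,
      [/\ strong_module M, M x & M y] & M `<=` N).
    by apply: Or33 => z Sz; apply: MN; exact: Sz.
  apply: Or32 => z Nz M hM; case: (hM) => -[_ _ /(_ _ modN) []] //.
  + by move=> e; case: nodisj; exists M.
  + by move=> s _ _; exact: s.
  + by move=> s; case: nosub; exists M.
Qed.

Lemma strong_module_comparable M N x :
  strong_module M -> strong_module N -> M x -> N x -> M `<=` N \/ N `<=` M.
Proof.
move=> [_ modM _] [_ _ /(_ _ modM) []] // e Mx Nx; [|by left|by right].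
by exfalso; rewrite -[False]/(set0 x) -e.
Qed.

End Modules.

Section Subsets.
Context {d : Order.disp_t} {G : orderedGroupType d}.
Implicit Types H K L M : set G.

Definition subgroup H := group_closed [in H].

Definition normal_subgroup K :=
  subgroup K /\ forall g k, K k -> K (k ^ g).

(* V(G) *)
Definition canonical_subgroups : set (set G) :=
  [set least_strong_module 1 g | g in [set g : G | g <> 1]].

(* H^- *)
Definition predecessor H : set G :=
  [set 1] `|` \bigcup_(L in [set L | canonical_subgroups L /\ L `<` H]) L.

Lemma subgroupP H :
  subgroup H <->
  [/\ H 1, forall x y, H x -> H y -> H (x * y) & forall x, H x -> H x^-1].
Proof.
split=> [gH|[H1 HM HV]]; last first.
  by split=> [|x y]; rewrite !inE //= => /HM Hx /HV; exact: Hx.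
have [H1 _] := gH; split; first by rewrite inE /= in H1.
- move=> x y Hx Hy; have := group_closedM gH.
  by move=> /(_ x y); rewrite !inE /=; apply.
- move=> x Hx; have := group_closedV gH.
  by move=> /(_ x); rewrite !inE /=; apply.
Qed.

Lemma le_mul2gE (a b x y : G) : (a * x * b <= a * y * b) = (x <= y).
Proof.
apply/idP/idP => [h|]; last exact: le_mulg2.
have := le_mulg2 a^-1 b^-1 _ _ h.
by rewrite !mulgA !mulVg !mul1g -!mulgA !mulgV !mulg1.
Qed.

Lemma le_mul2lE (a x y : G) : (a * x <= a * y) = (x <= y).
Proof. by rewrite -(le_mul2gE a 1) !mulg1. Qed.

Lemma le_mul2rE (b x y : G) : (x * b <= y * b) = (x <= y).
Proof. by rewrite -(le_mul2gE 1 b) !mul1g. Qed.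

Lemma leg_inv2 (x y : G) : (x^-1 <= y^-1) = (y <= x).
Proof. by rewrite -(le_mul2gE x y x^-1) mulgV mul1g -mulgA mulVg mulg1. Qed.

Lemma strong_module_preimage (f g : G -> G) M :
  cancel f g -> cancel g f ->
  (forall x y, (f x <= f y) = (x <= y)) \/
    (forall x y, (f x <= f y) = (y <= x)) ->
  strong_module M -> strong_module (f @^-1` M).
Proof.
move=> fK gK mono [[m Mm] modM strM].
split; first by exists (g m); rewrite /= gK.
- move=> x y z /= nM My Mz; have [a b] := modM _ _ _ nM My Mz.
  by case: mono => fm; move: a b; rewrite !fm.
move=> N modN.
have modN' : poset_module (g @^-1` N).
  move=> x y z /= nN Ny Nz; have [a b] := modN _ _ _ nN Ny Nz.
  case: mono => fm; move: a b.
  - have gm u v : (g u <= g v) = (u <= v) by rewrite -fm !gK.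
    by rewrite !gm.
  - have gm u v : (g u <= g v) = (v <= u) by rewrite -fm !gK.
    by rewrite !gm.
case: (strM _ modN') => [e|s|s].
- apply: Or31; rewrite -subset0 => z [Nz Mz].
  by rewrite -[set0 z]/(set0 (f z)) -e /=; split=> //=; rewrite fK.
- by apply: Or32 => z Nz; apply: s; rewrite /= fK.
- by apply: Or33 => z /s /=; rewrite fK.
Qed.

Lemma strong_module_translatel (a : G) M :
  strong_module M -> strong_module [set x | M (a * x)].
Proof.
apply: (strong_module_preimage (g := fun x => a^-1 * x)).
- by move=> x; rewrite mulgA mulVg mul1g.
- by move=> x; rewrite mulgA mulgV mul1g.
- by left=> x y; rewrite le_mul2lE.
Qed.

Lemma strong_module_translater (a : G) M :
  strong_module M -> strong_module [set x | M (x * a)].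
Proof.
apply: (strong_module_preimage (g := fun x => x * a^-1)).
- by move=> x; rewrite -mulgA mulgV mulg1.
- by move=> x; rewrite -mulgA mulVg mulg1.
- by left=> x y; rewrite le_mul2rE.
Qed.

Lemma strong_module_inv M :
  strong_module M -> strong_module [set x | M x^-1].
Proof.
apply: (strong_module_preimage (g := inv)) => [x|x|]; rewrite ?invgK //.
by right=> x y; rewrite leg_inv2.
Qed.

Lemma strong_module_invE M x : strong_module M -> M 1 -> M x -> M x^-1.
Proof.
move=> sM M1 Mx; have sV := strong_module_inv sM.
have V1 : [set x | M x^-1] 1 by rewrite /= invg1.
case: (strong_module_comparable sM sV M1 V1); first exact.
by move=> s; apply: s; rewrite /= invgK.
Qed.

Lemma least_strong_module_mul (a b : G) :
  least_strong_module 1 a b ->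
  least_strong_module 1 a (a * b) /\ least_strong_module 1 a (b * a).
Proof.
have [sS S1 Sa minS] := least_strong_moduleP 1 a.
move=> Sb.
have Sbv := strong_module_invE sS S1 Sb.
have sub (T : set G) : strong_module [set x | T x^-1] ->
    T 1 -> T a^-1 -> least_strong_module 1 a `<=` [set x | T x^-1].
  by move=> sT T1 Ta; apply: minS; rewrite //= invg1.
split.
- have := strong_module_inv (strong_module_translatel a sS).
  move=> /(sub [set x | _ (a * x)]) /=; rewrite mulg1 mulgV.
  by move=> /(_ Sa S1) /(_ _ Sbv); rewrite /= invgK.
- have := strong_module_inv (strong_module_translater a sS).
  move=> /(sub [set x | _ (x * a)]) /=; rewrite mul1g mulVg.
  by move=> /(_ Sa S1) /(_ _ Sbv); rewrite /= invgK.
Qed.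

Lemma strong_module_subgroup H : strong_module H -> H 1 -> subgroup H.
Proof.
move=> sH H1; apply/subgroupP; split=> //; last first.
  by move=> x; exact: strong_module_invE.
move=> x y Hx Hy.
have [sx x1 xx minx] := least_strong_moduleP 1 x.
have [sy y1 yy miny] := least_strong_moduleP 1 y.
case: (strong_module_comparable sx sy x1 y1) => [/(_ _ xx)|/(_ _ yy)].
- by move/least_strong_module_mul => [_ /(miny _ sH H1 Hy)].
- by move/least_strong_module_mul => [/(minx _ sH H1 Hx)].
Qed.

Lemma canonical_strong_module H :
  canonical_subgroups H -> strong_module H /\ H 1.
Proof. by move=> [g _ <-]; have [] := least_strong_moduleP 1 g. Qed.

Lemma canonical_subgroup H : canonical_subgroups H -> subgroup H.
Proof. by move=> /canonical_strong_module[]; exact: strong_module_subgroup. Qed.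

Lemma strong_module_set1 : strong_module [set (1 : G)].
Proof.
split; first by exists 1.
- by move=> x m m' _ -> ->.
- move=> N modN; have [N1|nN1] := pselect (N 1).
    by apply: Or33 => x ->.
  by apply: Or31; rewrite -subset0 => x [Nx x1]; apply: nN1; rewrite -x1.
Qed.

Lemma predecessor_sub H : canonical_subgroups H -> predecessor H `<=` H.
Proof.
move=> /canonical_strong_module[_ H1] x [->//|[L [_ [LH _]] Lx]].
exact: LH.
Qed.

Lemma predecessor_strong_module H : strong_module (predecessor H).
Proof.
pose F : set (set G) :=
  [set L | L = [set 1] \/ (canonical_subgroups L /\ L `<` H)].
have FE : predecessor H = \bigcup_(L in F) L.
  apply/seteqP; split=> x.
  - move=> [->|[L hL Lx]]; first by exists [set 1] => //; left.
    by exists L => //; right.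
  - by move=> [L [->|hL]] Lx; [left|right; exists L].
have F1 L : F L -> strong_module L /\ L 1.
  move=> [->|[/canonical_strong_module //]].
  by split=> //; exact: strong_module_set1.
have F0 : F [set 1] by left.
rewrite FE; split; first by exists 1; exists [set 1].
- move=> x m m' nx [L FL Lm] [L' FL' L'm'].
  have [[sL L1] [sL' L'1]] := (F1 _ FL, F1 _ FL').
  case: (strong_module_comparable sL sL' L1 L'1) => s.
  + by have [_ modL _] := sL'; apply: modL => //;
      [by move=> ?; apply: nx; exists L'|exact: s].
  + by have [_ modL _] := sL; apply: modL => //;
      [by move=> ?; apply: nx; exists L|exact: s].
- move=> N modN.
  have [[L [FL NL]]|nsub] := pselect (exists L, F L /\ N `<=` L).
    by apply: Or32 => x /NL Lx; exists L.
  have [N1|nN1] := pselect (N 1).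
  + apply: Or33 => x [L FL Lx]; have [[_ _ /(_ _ modN) NL] L1] := F1 _ FL; case: NL.
    * by move=> e; exfalso; rewrite -[False]/(set0 (1 : G)) -e.
    * by move=> s; case: nsub; exists L.
    * exact.
  + apply: Or31; rewrite -subset0 => x [Nx [L FL Lx]].
    have [[_ _ /(_ _ modN) NL] L1] := F1 _ FL; case: NL.
    * by move=> <-.
    * by move=> s; case: nsub; exists L.
    * by move=> /(_ _ L1).
Qed.

Lemma predecessor1 H : predecessor H 1. Proof. by left. Qed.

Lemma least_strong_module_conj (g a x : G) :
  least_strong_module 1 a x -> least_strong_module 1 (a ^ g) (x ^ g).
Proof.
move=> Sx M [sM M1 Ma].
have sM' : strong_module [set x | M (x ^ g)].
  exact: strong_module_translater (strong_module_translatel g^-1 sM).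
by apply: (Sx [set x | M (x ^ g)]); split=> //=; rewrite /conjg mul1g mulVg.
Qed.

Lemma predecessor_conj H g x :
  canonical_subgroups H -> H g -> predecessor H x -> predecessor H (x ^ g).
Proof.
move=> cH Hg; have /subgroupP[H1 HM HV] := canonical_subgroup cH.
have conjH y h : H h -> H y -> H (y ^ h).
  by move=> Hh Hy; apply: (HM); [exact: HV|exact: HM].
move=> [->|[L [[a a1 <-{L}] [LH nHL]] Lx]].
  by left; rewrite /= /conjg mul1g mulVg.
have conjK (y : G) : (y ^ g^-1) ^ g = y.
  by rewrite /conjg invgK !mulgA mulVg mul1g -mulgA mulVg mulg1.
have conjVK (y : G) : (y ^ g) ^ g^-1 = y.
  by rewrite /conjg invgK !mulgA mulgV mul1g -mulgA mulgV mulg1.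
right; exists (least_strong_module 1 (a ^ g)); last first.
  exact: least_strong_module_conj.
have [sS S1 Sa minS] := least_strong_moduleP 1 a.
have [sH _] := canonical_strong_module cH.
split; first exists (a ^ g) => //=.
  by move=> e; apply: a1; rewrite -(conjVK a) e /conjg mul1g mulVg.
split.
- have [_ _ _ minag] := least_strong_moduleP 1 (a ^ g).
  by apply: minag => //; apply: conjH => //; exact: LH.
- move=> HS; apply: nHL => y Hy.
  have := @least_strong_module_conj g^-1 (a ^ g) (y ^ g).
  by rewrite !conjVK; apply; apply: HS; exact: conjH.
Qed.

End Subsets.

Arguments canonical_subgroups {d} G.

Section SubgroupType.
Context {d : Order.disp_t} {G : orderedGroupType d} (H : set G).

Definition subgroup_type of subgroup H : Type := set_type H.

Variable sH : subgroup H.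
Local Notation T := (subgroup_type sH).

HB.instance Definition _ := SubChoice.on T.
HB.instance Definition _ := SubChoice_isSubGroup.Build G [in H] T sH.
HB.instance Definition _ := [SubChoice_isSubPOrder of T by <: with d].

Fact subgroup_le_mulg2 (a b x y : T) : x <= y -> a * x * b <= a * y * b.
Proof. rewrite -!Order.le_val !valM; exact: le_mulg2. Qed.

HB.instance Definition _ :=
  Group_POrder_isOrderedGroup.Build d T subgroup_le_mulg2.

End SubgroupType.

(* An element of G / K is a coset g K, as a subset of G; products and inverses
   of cosets are computed setwise. *)
Section Quotient.
Context {d : Order.disp_t} {G : orderedGroupType d}.

Definition lcoset (K : set G) (g : G) : set G := [set g * k | k in K].

Definition convex_normal (K : set G) := normal_subgroup K /\ convex K.

Variable K : set G.

Definition quotient of convex_normal K : Type := set_type (range (lcoset K)).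

Hypothesis hK : convex_normal K.
Local Notation T := (quotient hK).

HB.instance Definition _ := SubChoice.on T.

Definition coset (g : G) : T := SigSub (mem_set (imageT (lcoset K) g)).

Let K1 : K 1.
Proof. by have [[/subgroupP[]]] := hK. Qed.

Let KM x y : K x -> K y -> K (x * y).
Proof. by have [[/subgroupP[_ KM _] _] _] := hK; exact: KM. Qed.

Let KV x : K x -> K x^-1.
Proof. by have [[/subgroupP[_ _ KV] _] _] := hK; exact: KV. Qed.

Let KJ g x : K x -> K (x ^ g).
Proof. by have [[_ KJ] _] := hK; exact: KJ. Qed.

Lemma lcosetP g x : lcoset K g x <-> K (g^-1 * x).
Proof.
split=> [[k Kk <-]|Kx]; first by rewrite mulgA mulVg mul1g.
by exists (g^-1 * x) => //; rewrite mulgA mulgV mul1g.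
Qed.

Lemma lcoset_eqP g h : lcoset K g = lcoset K h <-> K (g^-1 * h).
Proof.
split=> [e|Kgh].
  by apply/lcosetP; rewrite e; apply/lcosetP; rewrite mulVg.
apply/seteqP; split=> x /lcosetP Kx; apply/lcosetP.
- have -> : h^-1 * x = (g^-1 * h)^-1 * (g^-1 * x).
    by rewrite invgM invgK -mulgA (mulgA g) mulgV mul1g.
  by apply: KM => //; exact: KV.
- have -> : g^-1 * x = (g^-1 * h) * (h^-1 * x).
    by rewrite -mulgA (mulgA h) mulgV mul1g.
  exact: KM.
Qed.

Lemma coset_eqP g h : coset g = coset h <-> K (g^-1 * h).
Proof.
split=> [/(congr1 val)/lcoset_eqP //|/lcoset_eqP e].
exact: val_inj.
Qed.

Lemma coset_surj (A : T) : exists g, A = coset g.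
Proof.
have [g _ e] := set_mem (valP A).
by exists g; apply: val_inj; rewrite -e.
Qed.

Lemma lcosetM g h :
  [set a * b | a in lcoset K g & b in lcoset K h] = lcoset K (g * h).
Proof.
apply/seteqP; split=> x.
- move=> [_ [k Kk <-] [_ [l Kl <-] <-]]; exists (k ^ h * l).
    by apply: KM => //; exact: KJ.
  by rewrite /conjg !mulgA -(mulgA g h h^-1) mulgV mulg1.
- move=> [k Kk <-]; exists g; first by exists 1; rewrite ?mulg1.
  by exists (h * k); [exists k|rewrite mulgA].
Qed.

Lemma lcosetV g : [set a^-1 | a in lcoset K g] = lcoset K g^-1.
Proof.
apply/seteqP; split=> x.
- move=> [_ [k Kk <-] <-]; apply/lcosetP; rewrite invgK invgM.
  by have := KJ g^-1 (KV Kk); rewrite /conjg invgK.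
- move=> [k Kk <-]; exists (k^-1 * g); last by rewrite invgM invgK.
  by apply/lcosetP; have := KJ g (KV Kk).
Qed.

Fact quotient_mul_subproof (A B : T) :
  [set a * b | a in val A & b in val B] \in range (lcoset K).
Proof.
have [[g ->] [h ->]] := (coset_surj A, coset_surj B).
by apply/mem_set; rewrite lcosetM; exists (g * h).
Qed.

Fact quotient_inv_subproof (A : T) :
  [set a^-1 | a in val A] \in range (lcoset K).
Proof.
have [g ->] := coset_surj A.
by apply/mem_set; rewrite lcosetV; exists g^-1.
Qed.

Definition quotient_mul (A B : T) : T := SigSub (quotient_mul_subproof A B).
Definition quotient_inv (A : T) : T := SigSub (quotient_inv_subproof A).
Definition quotient_le (A B : T) : bool :=
  `[< exists a b, [/\ val A a, val B b & a <= b] >].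

Lemma quotient_mulE g h : quotient_mul (coset g) (coset h) = coset (g * h).
Proof. by apply: val_inj; exact: lcosetM. Qed.

Lemma quotient_invE g : quotient_inv (coset g) = coset g^-1.
Proof. by apply: val_inj; exact: lcosetV. Qed.

Lemma quotient_leP g h :
  reflect (exists2 k, K k & g <= h * k) (quotient_le (coset g) (coset h)).
Proof.
apply: (iffP (asboolP _)) => [[_ [_ [[k Kk <-] [l Kl <-] le]]]|[k Kk le]].
  exists (l * k^-1); first by apply: KM => //; exact: KV.
  by rewrite -(le_mul2rE k) -!mulgA mulVg mulg1.
exists g, (h * k); split=> //; last by exists k.
by exists 1; rewrite ?mulg1.
Qed.

Fact quotient_mulA : associative quotient_mul.
Proof.
move=> A B C; have [[a ->] [b ->]] := (coset_surj A, coset_surj B).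
by have [c ->] := coset_surj C; rewrite !quotient_mulE mulgA.
Qed.

Fact quotient_mul1 : left_id (coset 1) quotient_mul.
Proof. by move=> A; have [a ->] := coset_surj A; rewrite quotient_mulE mul1g. Qed.

Fact quotient_1mul : right_id (coset 1) quotient_mul.
Proof. by move=> A; have [a ->] := coset_surj A; rewrite quotient_mulE mulg1. Qed.

Fact quotient_mulV : left_inverse (coset 1) quotient_inv quotient_mul.
Proof.
move=> A; have [a ->] := coset_surj A.
by rewrite quotient_invE quotient_mulE mulVg.
Qed.

Fact quotient_Vmul : right_inverse (coset 1) quotient_inv quotient_mul.
Proof.
move=> A; have [a ->] := coset_surj A.
by rewrite quotient_invE quotient_mulE mulgV.
Qed.

HB.instance Definition _ := isGroup.Build T
  quotient_mulA quotient_mul1 quotient_1mul quotient_mulV quotient_Vmul.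

Fact quotient_le_refl : reflexive quotient_le.
Proof.
move=> A; have [a ->] := coset_surj A.
by apply/quotient_leP; exists 1; rewrite ?mulg1.
Qed.

Fact quotient_le_anti : antisymmetric quotient_le.
Proof.
move=> A B; have [[a ->] [b ->]] := (coset_surj A, coset_surj B).
move=> /andP[/quotient_leP[k Kk ab] /quotient_leP[l Kl ba]].
apply/coset_eqP; have [_ cvxK] := hK.
have Kabk : K (a^-1 * (b * k)).
  apply: (cvxK 1 _ (l * k)) => //; first exact: KM.
  - by rewrite -(le_mul2lE a) mulg1 mulgA mulgV mul1g.
  - by rewrite -(le_mul2lE a) !mulgA mulgV mul1g le_mul2rE.
have -> : a^-1 * b = (a^-1 * (b * k)) * k^-1.
  by rewrite -!mulgA mulgV mulg1.
by apply: KM => //; exact: KV.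
Qed.

Fact quotient_le_trans : transitive quotient_le.
Proof.
move=> B A C; have [[a ->] [b ->]] := (coset_surj A, coset_surj B).
have [c ->] := coset_surj C.
move=> /quotient_leP[k Kk ab] /quotient_leP[l Kl bc].
apply/quotient_leP; exists (l * k); first exact: KM.
by apply: (le_trans ab); rewrite mulgA le_mul2rE.
Qed.

HB.instance Definition _ := Order.Le_isPOrder.Build d T
  quotient_le_refl quotient_le_anti quotient_le_trans.

Fact quotient_le_mulg2 (A B X Y : T) : X <= Y -> A * X * B <= A * Y * B.
Proof.
have [[a ->] [b ->]] := (coset_surj A, coset_surj B).
have [[x ->] [y ->]] := (coset_surj X, coset_surj Y).
move=> /quotient_leP[k Kk xy].
rewrite -[_ <= _]/(quotient_le _ _) -[_ * coset x]/(quotient_mul _ _).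
rewrite -[_ * coset y]/(quotient_mul _ _) -![_ * coset b]/(quotient_mul _ _).
rewrite !quotient_mulE; apply/quotient_leP; exists (k ^ b); first exact: KJ.
have -> : a * y * b * k ^ b = a * (y * k) * b.
  by rewrite /conjg !mulgA -(mulgA (a * y) b b^-1) mulgV mulg1.
by rewrite le_mul2gE.
Qed.

HB.instance Definition _ :=
  Group_POrder_isOrderedGroup.Build d T quotient_le_mulg2.

Lemma coset_leP g h : reflect (exists2 k, K k & g <= h * k) (coset g <= coset h).
Proof. exact: quotient_leP. Qed.

Lemma cosetM g h : coset (g * h) = coset g * coset h.
Proof. by rewrite -quotient_mulE. Qed.

Lemma coset1 : coset 1 = 1. Proof. by []. Qed.

End Quotient.

Arguments coset {d G K} hK g.

Lemma strong_normal {d : Order.disp_t} {G : orderedGroupType d} {K : set G} :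
  normal_subgroup K -> strong_module K -> convex_normal K.
Proof. by move=> nK /strong_module_convex. Qed.

Section CanonicalFactor.
Context {d : Order.disp_t} {G : orderedGroupType d} {H : set G}.
Hypothesis cH : canonical_subgroups G H.
Local Notation T := (subgroup_type (canonical_subgroup cH)).

Lemma predecessor_convex_normal :
  convex_normal ((val : T -> G) @^-1` predecessor H).
Proof.
have /subgroupP[p1 pM pV] : subgroup (predecessor H).
  exact: strong_module_subgroup (predecessor_strong_module H) (predecessor1 H).
split; first split.
- apply/subgroupP; split; rewrite /= ?val1 //.
  + by move=> x y; exact: pM.
  + by move=> x; exact: pV.
- move=> g k pk; have Hg : H (val g) := set_mem (valP g).
  exact: (predecessor_conj cH Hg pk).
- move=> x y z /= px pz; rewrite -!Order.le_val.
  exact: (strong_module_convex (predecessor_strong_module H)).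
Qed.

(* H^- is in general normal in H only, so that H / H^- is the quotient of the
   ordered group H by H^- seen as a subset of H. *)
Definition canonical_factor := quotient predecessor_convex_normal.

HB.instance Definition _ := OrderedGroup.on canonical_factor.

Definition factor_coset (h : T) : canonical_factor :=
  coset predecessor_convex_normal h.

End CanonicalFactor.

Arguments canonical_factor {d G H} cH.
Arguments factor_coset {d G H} cH h.

Definition ordered_group_isomorphism {d d' : Order.disp_t}
    {A : orderedGroupType d} {B : orderedGroupType d'} (f : A -> B) :=
  [/\ bijective f, {morph f : x y / x * y} & {mono f : x y / x <= y}].

(* Main.v *)
Require Import Defs.
From mathcomp Require Import all_boot all_order.
From mathcomp Require Import boolp classical_sets.

Local Open Scope order_scope.
Local Open Scope group_scope.
Local Open Scope classical_set_scope.

(** Distinct cosets of K compare in G/K exactly as their elements do in G,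
   because the cosets of K are modules. Hence images and preimages under
   q : G -> G/K preserve modules. Moreover a module of G is a union of cosets
   of K unless it lies in a single coset, because the cosets are strong. So
   H |-> q(H) is a bijection from the strong modules of G containing K to the
   strong modules of G/K containing the identity. *)

Lemma factor_coset_surj {d : Order.disp_t} {G : orderedGroupType d} {H : set G}
    (cH : canonical_subgroups G H) (A : canonical_factor cH) :
  exists h, A = factor_coset cH h.
Proof. exact: coset_surj. Qed.

Section QuotientModules.
Set Implicit Arguments.
Unset Strict Implicit.
Import Order.TTheory.
Context {d : Order.disp_t} {G : orderedGroupType d} {K : set G}.
Hypotheses (nK : normal_subgroup K) (sK : strong_module K).
Local Notation q := (coset (strong_normal nK sK)).
Implicit Types (M N H L : set G) (g h : G).

(** * Cosets of [K] and the order of the quotient *)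

Lemma normal_subgroup1 : K 1.
Proof. by have [/subgroupP[]] := nK. Qed.

(** Left translations are order automorphisms, so every coset inherits strength from [K]. *)
Lemma lcoset_strong_module g : strong_module (lcoset K g).
Proof.
have -> : lcoset K g = [set x | K (g^-1 * x)].
  by apply/seteqP; split=> x /lcosetP.
exact: strong_module_translatel.
Qed.

Lemma coset_eq1P g : q g = 1 <-> K g.
Proof.
rewrite -coset1; split=> [/esym/coset_eqP|Kg]; first by rewrite invg1 mul1g.
by apply/esym/coset_eqP; rewrite invg1 mul1g.
Qed.

(** The coset of [h] is a module that misses [g], so [g] lies below some [h * k] exactly when it
    lies below [h]. *)
Lemma coset_le g h : q g <> q h -> (q g <= q h) = (g <= h).
Proof.
move=> ngh; apply/coset_leP/idP => [[k Kk gk]|gh]; last first.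
  by exists 1; rewrite ?mulg1 //; exact: normal_subgroup1.
have [_ modK _] := lcoset_strong_module h.
have nKg : ~ lcoset K h g by move/lcosetP/coset_eqP/esym.
have hk : lcoset K h (h * k) by exists k.
have hh : lcoset K h h by exists 1; rewrite ?mulg1 //; exact: normal_subgroup1.
by have [[le _] _] := modK g _ _ nKg hk hh; exact: le.
Qed.

(** * Transfer of modules and strong modules along [q] *)

Lemma poset_module_coset_preimage (M : set (quotient (strong_normal nK sK))) :
  poset_module M -> poset_module (q @^-1` M).
Proof.
move=> modM x m m' /= nM Mm Mm'.
have xm y : M (q y) -> q x <> q y by move=> My e; apply: nM; rewrite e.
have mx y : M (q y) -> q y <> q x by move=> My /esym; exact: xm.
have := modM _ _ _ nM Mm Mm'.
by rewrite !coset_le //; [exact: mx|exact: mx|exact: xm|exact: xm].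
Qed.

Lemma poset_module_coset_image N : poset_module N -> poset_module (q @` N).
Proof.
move=> modN X _ _ nX [m Nm <-] [m' Nm' <-].
(* As [X] is outside the image, its coset misses [N], so [coset_le] applies between [x] and each
   point of [N]. *)
have [x ex] := coset_surj X; rewrite {X}ex in nX *.
have nx : ~ N x by move=> Nx; apply: nX; exists x.
have xm y : N y -> q x <> q y by move=> Ny e; apply: nX; exists y.
have mx y : N y -> q y <> q x by move=> Ny /esym; exact: xm.
by rewrite !coset_le; [exact: modN|exact: mx|exact: mx|exact: xm|exact: xm].
Qed.

Lemma strong_module_coset_preimage
    (M : set (quotient (strong_normal nK sK))) :
  strong_module M -> strong_module (q @^-1` M).
Proof.
move=> [[A MA] modM strM]; split.
- by have [a ea] := coset_surj A; exists a; rewrite /= -ea.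
- exact: poset_module_coset_preimage.
move=> N modN; have [e|s|s] := strM _ (poset_module_coset_image modN).
- apply: Or31; rewrite -subset0 => x [Nx Mx].
  by rewrite -[set0 x]/(set0 (q x)) -e; split=> //; exists x.
- by apply: Or32 => x Nx; apply: s; exists x.
- have [[n [Nn nsub]]|sat] :=
      pselect (exists n, N n /\ ~ lcoset K n `<=` N); last first.
    apply: Or33 => x /s [n Nn /coset_eqP Kx].
    have [nsub|//] := pselect (lcoset K n `<=` N).
      by apply: nsub; apply/lcosetP.
    by move=> nsub; case: sat; exists n.
  (* Strength of the coset of [n] now forces [N] inside it, so [q] is constant on [N]. *)
  have [_ _ /(_ _ modN)[e|Nsub|//]] := lcoset_strong_module n.
    exfalso; rewrite -[False]/(set0 n) -e; split=> //.
    by exists 1; rewrite ?mulg1 //; exact: normal_subgroup1.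
  have qN x : N x -> q x = q n.
    by move=> /Nsub/lcosetP/coset_eqP/esym.
  (* The nonempty [M] lies in the single point [q n], hence contains it. *)
  apply: Or32 => x Nx /=; rewrite qN //.
  by have [y Ny e] := s _ MA; rewrite -(qN y Ny) e.
Qed.

(** A strong module containing [K] is a subgroup, hence a union of cosets of [K]. *)
Lemma coset_image_saturated H g : strong_module H -> K `<=` H ->
  (q @` H) (q g) <-> H g.
Proof.
move=> sH KH; split=> [[h Hh /coset_eqP Kg]|Hg]; last by exists g.
have /subgroupP[_ HM _] := strong_module_subgroup sH (KH _ normal_subgroup1).
have -> : g = h * (h^-1 * g) by rewrite mulgA mulgV mul1g.
by apply: HM => //; exact: KH.
Qed.

Lemma strong_module_coset_image H : strong_module H -> K `<=` H ->
  strong_module (q @` H).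
Proof.
move=> sH KH; have [_ modH strH] := sH; split.
- by exists (q 1); exists 1 => //; exact: KH normal_subgroup1.
- exact: poset_module_coset_image.
move=> N modN; have [e|s|s] := strH _ (poset_module_coset_preimage modN).
- apply: Or31; rewrite -subset0 => X [NX [x Hx ex]].
  by rewrite -[set0 X]/(set0 x) -e; split=> //=; rewrite ex.
- apply: Or32 => X NX; have [x ex] := coset_surj X; exists x => //.
  by apply: s; rewrite /= -ex.
- by apply: Or33 => _ [x Hx <-]; exact: s.
Qed.

Lemma coset_image_proper H L :
    strong_module H -> K `<=` H -> strong_module L -> K `<=` L ->
  q @` L `<` q @` H <-> L `<` H.
Proof.
move=> sH KH sL KL.
have sub M N : strong_module N -> K `<=` N ->
    q @` M `<=` q @` N <-> M `<=` N.
  move=> sN KN; split=> s x; last by move=> [y /s Ny <-]; exists y.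
  by move=> Mx; apply/coset_image_saturated => //; apply: s; exists x.
by split=> -[LH nHL]; split; rewrite ?sub // in LH nHL *;
  move=> /sub ?; apply: nHL; apply/sub.
Qed.

(** * Least strong modules, canonical subgroups and predecessors in the quotient *)

(** Minimality is used on both sides: the image of one least strong module and the preimage of the
    other are strong modules containing the required points. *)
Lemma least_strong_module_coset g : ~ K g ->
  least_strong_module 1 (q g) = q @` least_strong_module 1 g.
Proof.
move=> nKg; have [sS S1 Sg minS] := least_strong_moduleP 1 g.
have [sQ Q1 Qg minQ] := least_strong_moduleP 1 (q g).
(* Two strong modules sharing [1] are comparable, and [g] lies outside [K]. *)
have KS : K `<=` least_strong_module 1 g.
  have [//|s] := strong_module_comparable sK sS normal_subgroup1 S1.
  by case: nKg; exact: s.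
apply/seteqP; split.
- apply: minQ; first exact: strong_module_coset_image.
  + by exists 1.
  + by exists g.
- move=> _ [x Sx <-].
  by apply: (minS (q @^-1` least_strong_module 1 (q g))) => //;
    exact: strong_module_coset_preimage.
Qed.

(** The least strong module of [1] and [g] strictly contains [K] exactly when [g] is outside [K],
    that is, when [q g] is not the identity. *)
Lemma canonical_subgroups_coset :
  canonical_subgroups (quotient (strong_normal nK sK)) =
    [set q @` H | H in [set H | canonical_subgroups G H /\ K `<` H]].
Proof.
apply/seteqP; split=> [_ [A A1 <-]|_ [_ [[g g1 <-] [KS nSK]] <-]].
- have [g eg] := coset_surj A; rewrite {A}eg in A1 *.
  have nKg : ~ K g by move=> /coset_eq1P.
  have [sS S1 Sg minS] := least_strong_moduleP 1 g.
  exists (least_strong_module 1 g); last by rewrite least_strong_module_coset.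
  split.
    by exists g => // g1; apply: nKg; rewrite g1; exact: normal_subgroup1.
  split; last by move=> /(_ _ Sg).
  have [//|s] := strong_module_comparable sK sS normal_subgroup1 S1.
  by case: nKg; exact: s.
- have nKg : ~ K g.
    move=> Kg; apply: nSK; have [_ _ _] := least_strong_moduleP 1 g.
    by apply => //; exact: normal_subgroup1.
  exists (q g); last by rewrite least_strong_module_coset.
  by move=> /coset_eq1P.
Qed.

(** Each nontrivial [k] in [K] generates a canonical subgroup inside [K], hence strictly below
    [H]. *)
Lemma sub_predecessor H : K `<` H -> strong_module H -> K `<=` predecessor H.
Proof.
move=> [KH nHK] sH k Kk; have [->|k1] := pselect (k = 1); first by left.
have [sS S1 Sk minS] := least_strong_moduleP 1 k.
have SK : least_strong_module 1 k `<=` K.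
  by apply: minS => //; exact: normal_subgroup1.
right; exists (least_strong_module 1 k) => //; split; first by exists k.
split; first by move=> x /SK; exact: KH.
by move=> s; apply: nHK => x /s; exact: SK.
Qed.

Lemma predecessor_coset H : canonical_subgroups G H -> K `<` H ->
  predecessor (q @` H) = q @` predecessor H.
Proof.
move=> cH KH; have [sH H1] := canonical_strong_module cH.
have KH' : K `<=` H by case: KH.
apply/seteqP; split=> [X [->|[L' [cL' L'H] L'X]]|_ [x [->|[L [cL LH] Lx]] <-]].
- by exists 1; [left|].
- move: cL'; rewrite canonical_subgroups_coset => -[L [cL [KL _]] eL].
  rewrite -{L'}eL in L'H L'X.
  have [sL L1] := canonical_strong_module cL.
  have [x Lx <-] := L'X; exists x => //; right; exists L => //; split=> //.
  exact: (coset_image_proper sH KH' sL KL).1 L'H.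
- by left.
- have [sL L1] := canonical_strong_module cL.
  have [Kx|nKx] := pselect (K x); first by left; apply/coset_eq1P.
  have [KL|LK] := strong_module_comparable sK sL normal_subgroup1 L1; last first.
    by case: nKx; exact: LK.
  right; exists (q @` L); last by exists x.
  split; last exact: (coset_image_proper sH KH' sL KL).2 LH.
  rewrite canonical_subgroups_coset; exists L => //; split=> //.
  by split=> // s; apply: nKx; exact: s.
Qed.

(** * Isomorphism of the canonical factors *)

Section Factor.
Context {H : set G}.
Hypotheses (cH : canonical_subgroups G H)
  (cHK : canonical_subgroups (quotient (strong_normal nK sK)) (q @` H))
  (KH : K `<` H).
Local Notation TH := (subgroup_type (canonical_subgroup cH)).
Local Notation THK := (subgroup_type (canonical_subgroup cHK)).

(** Both sides compare [h] with [h'] up to a factor from the predecessor of [H]; passing to the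
    quotient adds only a factor from [K], which that predecessor absorbs. *)
Lemma factor_coset_le (h h' : TH) (x x' : THK) :
    val x = q (val h) -> val x' = q (val h') ->
  (factor_coset cHK x <= factor_coset cHK x') =
    (factor_coset cH h <= factor_coset cH h').
Proof.
move=> xh xh'; have KP := sub_predecessor KH (canonical_strong_module cH).1.
have /subgroupP[_ PM _] := strong_module_subgroup
  (predecessor_strong_module H) (predecessor1 H).
have PH := predecessor_sub cH.
apply/coset_leP/coset_leP => [[p]|[p]].
- rewrite /= (predecessor_coset cH KH) => -[y Py ey].
  have {}ey : val p = q y by [].
  rewrite -Order.le_val valM xh xh' ey -cosetM => /coset_leP[k Kk le].
  have Pyk : predecessor H (y * k) by apply: PM => //; exact: KP.
  exists (SigSub (mem_set (PH _ Pyk))) => //.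
  by rewrite -Order.le_val valM /= mulgA.
- move=> /= Pp; rewrite -Order.le_val valM => le.
  have Qp : (q @` H) (q (val p)) by exists (val p) => //; exact: PH.
  exists (SigSub (mem_set Qp)).
    by rewrite /= (predecessor_coset cH KH); exists (val p).
  rewrite -Order.le_val valM xh xh' /= -cosetM; apply/coset_leP.
  by exists 1; [exact: normal_subgroup1|rewrite mulg1].
Qed.

Lemma canonical_factor_iso :
  exists2 f : canonical_factor cHK -> canonical_factor cH,
    ordered_group_isomorphism f &
    forall (h : TH) (x : THK), val x = q (val h) ->
      f (factor_coset cHK x) = factor_coset cH h.
Proof.
(* [R] is the graph of the isomorphism, written with representatives. It is total on both sides, and
   since it preserves and reflects the order, antisymmetry makes it single-valued in both
   directions. *)
pose R (A : canonical_factor cHK) (B : canonical_factor cH) :=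
  exists (h : TH) (x : THK), [/\ val x = q (val h), A = factor_coset cHK x &
    B = factor_coset cH h].
have Rle A A' B B' : R A B -> R A' B' -> (A <= A') = (B <= B').
  move=> [h [x [xh -> ->]]] [h' [x' [xh' -> ->]]]; exact: factor_coset_le.
have RM A A' B B' : R A B -> R A' B' -> R (A * A') (B * B').
  move=> [h [x [xh -> ->]]] [h' [x' [xh' -> ->]]].
  exists (h * h'), (x * x'); split; last 2 first.
  - exact/esym/cosetM.
  - exact/esym/cosetM.
  by rewrite !valM xh xh' cosetM.
have [f fR] : {f & forall A, R A (f A)}.
  apply: choice => A; have [x ->] := factor_coset_surj cHK A.
  have [h Hh eh] := set_mem (valP x).
  exists (factor_coset cH (SigSub (mem_set Hh))).
  by exists (SigSub (mem_set Hh)), x.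
have [g gR] : {g & forall B, R (g B) B}.
  apply: (choice (P := fun B A => R A B)) => B; have [h ->] := factor_coset_surj cH B.
  have Qh : (q @` H) (q (val h)).
    by exists (val h) => //; exact: set_mem (valP h).
  exists (factor_coset cHK (SigSub (mem_set Qh))).
  by exists h, (SigSub (mem_set Qh)).
have Rl A B B' : R A B -> R A B' -> B = B'.
  move=> r r'; apply/eqP.
  by rewrite eq_le -(Rle _ _ _ _ r r') -(Rle _ _ _ _ r' r) lexx.
have Rr A A' B : R A B -> R A' B -> A = A'.
  move=> r r'; apply/eqP.
  by rewrite eq_le (Rle _ _ _ _ r r') (Rle _ _ _ _ r' r) lexx.
exists f; last by move=> h x xh; apply: Rl (fR _) _; exists h, x.
split.
- exists g => [A|B]; first exact: Rr (gR _) (fR _).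
  exact: Rl (fR _) (gR _).
- by move=> A A'; apply: Rl (fR _) _; exact: RM.
- by move=> A A'; rewrite (Rle _ _ _ _ (fR A) (fR A')).
Qed.

End Factor.
End QuotientModules.

Theorem corollary3p5 (d : Order.disp_t) (G : orderedGroupType d) (K : set G)
    (nK : normal_subgroup K) (properK : K <> [set: G])
    (sK : strong_module K) :
  let G_K := quotient (strong_normal nK sK) in
  let q : G -> G_K := coset (strong_normal nK sK) in
  [/\ canonical_subgroups G_K =
        [set q @` H | H in [set H | canonical_subgroups G H /\ K `<` H]],
      forall g : G, ~ K g ->
        least_strong_module (1 : G_K) (q g) = q @` least_strong_module 1 g &
      forall (H : set G) (cH : canonical_subgroups G H), K `<` H ->
        [/\ K `<=` predecessor H,
            predecessor (q @` H) = q @` predecessor H &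
            exists cHK : canonical_subgroups G_K (q @` H),
            exists2 f : canonical_factor cHK -> canonical_factor cH,
              ordered_group_isomorphism f &
              forall (h : subgroup_type (canonical_subgroup cH))
                  (hK : subgroup_type (canonical_subgroup cHK)),
                val hK = q (val h) ->
                f (factor_coset cHK hK) = factor_coset cH h]].
Proof.
move=> G_K q; split=> [|g|H cH KH].
- exact: canonical_subgroups_coset.
- exact: least_strong_module_coset.
split.
- by apply: sub_predecessor => //; have [] := canonical_strong_module cH.
- exact: predecessor_coset.
- have cHK : canonical_subgroups G_K (q @` H).
    by rewrite /G_K canonical_subgroups_coset; exists H.
  by exists cHK; exact: canonical_factor_iso.
Qed.
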